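(* Let $f,g:\mathbf K\times\mathbf K\to\mathbb R$ be monotone and upper hemicontinuous bifunctions satisfying the standing assumptions in the context. Assume additionally that: (a) $g$ is $\rho$-strongly monotone for some $\rho>0$, i.e. $g(x,y)+g(y,x)\le-\rho\|x-y\|^2$ for all $x,y\in\mathbf K$; (b) the sequence $\{\alpha_n\}$ is nondecreasing; (c) $\{\alpha_n\}\subseteq[0,\alpha]$ for some $\alpha\in\left[0,\frac{\sqrt3-1}{4}\right)$, and $$\sum_{n\ge0}\lambda_n=+\infty,\quad \lim_{n\to+\infty}\lambda_n=0,\quad \lim_{n\to+\infty}\beta_n=+\infty,\quad \liminf_{n\to+\infty}\lambda_n\beta_n>0.$$ Then the sequence $\{x_n\}$ generated by the algorithm (IPSA) described in the context converges strongly to the unique solution $u$ of (BEP).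
   Context: $\mathcal H$ is a real Hilbert space with inner product $\langle\cdot,\cdot\rangle$ and norm $\|\cdot\|$; $\mathbf K\subseteq\mathcal H$ is nonempty, closed and convex; $f,g:\mathbf K\times\mathbf K\to\mathbb R$. Definitions. A bifunction $h:\mathbf K\times\mathbf K\to\mathbb R$ is monotone if $h(x,y)+h(y,x)\le 0$ for all $x,y\in\mathbf K$; upper hemicontinuous if $\lim_{t\searrow 0}h(tz+(1-t)x,y)\le h(x,y)$ for all $x,y,z\in\mathbf K$; an equilibrium bifunction if for each $x\in\mathbf K$, $h(x,x)=0$ and $h(x,\cdot)$ is convex and lower semicontinuous on $\mathbf K$. $\mathbf S_f=\{u\in\mathbf K: f(u,z)\ge 0\ \ \forall z\in\mathbf K\}$. The bilevel equilibrium problem (BEP) is: find $\bar x\in\mathbf S_f$ such that $g(\bar x,y)\ge0$ for all $y\in\mathbf S_f$. Its solution set is denoted $\mathbf S$. For $y\in\mathbf K$, $g_y:\mathcal H\to\mathbb R\cup\{+\infty\}$ is given by $g_y(x)=g(y,x)$ if $x\in\mathbf K$ and $+\infty$ otherwise; $\partial$ is the convex subdifferential. Standing assumptions: $\mathbf S\ne\emptyset$; $f$ and $g$ are monotone, upper hemicontinuous equilibrium bifunctions; $\partial g_y(y)\neq\emptyset$ for each $y\in\mathbf K$; $\mathbf K\cap\mathbf S_f\ne\emptyset$; the set $\mathbb R_+(\mathbf K-\mathbf S_f)=\{t(k-s):t\ge0,k\in\mathbf K,s\in\mathbf S_f\}$ is a closed linear subspace of $\mathcal H$. Algorithm (IPSA):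 given positive sequences $\{\beta_n\}$, $\{\lambda_n\}$, a nonnegative sequence $\{\alpha_n\}\subseteq[0,1]$, and arbitrary $x_0,x_1\in\mathbf K$, for every $n\ge1$ set $y_n=x_n+\alpha_n(x_n-x_{n-1})$ and let $z_{n+1},x_{n+1}\in\mathbf K$ be the (unique) points with $$g(z_{n+1},y)+\frac1{\lambda_n}\langle z_{n+1}-y_n,y-z_{n+1}\rangle\ge0\quad\forall y\in\mathbf K,$$ $$\beta_nf(x_{n+1},y)+\frac1{\lambda_n}\langle x_{n+1}-z_{n+1},y-x_{n+1}\rangle\ge0\quad\forall y\in\mathbf K.$$ *)

(* Defs.v *)
From HB Require Import structures.
From mathcomp Require Import all_boot all_order all_algebra.
From mathcomp Require Import all_classical all_reals all_analysis.

Set Implicit Arguments.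
Unset Strict Implicit.
Unset Printing Implicit Defensive.

Import Order.TTheory GRing.Theory Num.Theory.
Import numFieldNormedType.Exports.

Local Open Scope classical_set_scope.
Local Open Scope ring_scope.

(* A real Hilbert space is a complete normed module [H] over [R : realType]
   together with a positive definite symmetric bilinear form
   [ip : {dot H for idfun}] that induces the norm of [H]. *)
Definition induces_norm (R : realType) (H : completeNormedModType R)
    (ip : {dot H for idfun}) : Prop :=
  forall x : H, `|x| ^+ 2 = ip x x.

(* Real-valued bifunctions on K x K are represented by total functions
   [h : H -> H -> R]; every notion below depends only on the values of [h]
   on K x K. *)
Section Bifunctions.
Variables (R : realType) (H : completeNormedModType R).
Implicit Types (K : set H) (h : H -> H -> R).

Definition monotone_bifun K h : Prop :=
  forall x y, K x -> K y -> h x y + h y x <= 0.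

Definition strongly_monotone_bifun K h (rho : R) : Prop :=
  forall x y, K x -> K y -> h x y + h y x <= - rho * `|x - y| ^+ 2.

(* The limit at 0 from the right is taken in the extended reals. *)
Definition upper_hemicontinuous K h : Prop :=
  forall x y z, K x -> K y -> K z ->
    exists2 l : \bar R,
      (h (t *: z + (1 - t) *: x) y)%:E @[t --> 0^'+] --> l
      & (l <= (h x y)%:E)%E.

(* [subspace K] carries the topology in which neighborhoods of the points of
   K are relative to K and the points outside K are isolated, so that lower
   semicontinuity on [subspace K] is lower semicontinuity on K. *)
Definition equilibrium_bifun K h : Prop :=
  forall x, K x ->
    [/\ h x x = 0,
        convex_function (K : set (convex_lmodType H)) (h x)
      & lower_semicontinuous ((fun y => (h x y)%:E) : subspace K -> \bar R)].

(* S_h *)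
Definition equilibrium_set K h : set H :=
  [set u | K u /\ forall z, K z -> 0 <= h u z].

(* S *)
Definition bilevel_set K (f g : H -> H -> R) : set H :=
  [set u | equilibrium_set K f u /\
           forall y, equilibrium_set K f y -> 0 <= g u y].

(* R_+ (A - B) *)
Definition cone_diff (A B : set H) : set H :=
  [set v | exists t k s, [/\ 0 <= t, A k, B s & v = t *: (k - s)]].

Definition closed_linear_subspace (V : set H) : Prop :=
  submod_closed (mem V) /\ closed V.

End Bifunctions.

Section Subdifferential.
Variables (R : realType) (H : completeNormedModType R).
Variable ip : {dot H for idfun}.

Definition subdifferential (phi : H -> \bar R) (x : H) : set H :=
  [set p | phi x \is a fin_num /\
           forall y, (phi x + (ip p (y - x))%:E <= phi y)%E].

(* g_y *)
Definition extend_pinfty (K : set H) (g : H -> H -> R) (y : H) : H -> \bar R :=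
  fun x => if x \in K then (g y x)%:E else +oo%E.

Definition standing_assumptions (K : set H) (f g : H -> H -> R) : Prop :=
  [/\ bilevel_set K f g !=set0,
      [/\ monotone_bifun K f, upper_hemicontinuous K f
        & equilibrium_bifun K f],
      [/\ monotone_bifun K g, upper_hemicontinuous K g
        & equilibrium_bifun K g],
      (forall y, K y -> subdifferential (extend_pinfty K g y) y !=set0)
    & K `&` equilibrium_set K f !=set0 /\
      closed_linear_subspace (cone_diff K (equilibrium_set K f))].

(* The resolvent inequality
   b h(w, y) + (1/l) <w - v, y - w> >= 0 for all y in K, with w in K. *)
Definition resolvent_point (K : set H) (h : H -> H -> R) (b l : R)
    (v w : H) : Prop :=
  K w /\ forall y, K y -> 0 <= b * h w y + l^-1 * ip (w - v) (y - w).

(* y_n, used only for n >= 1 *)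
Definition inertial_point (alpha : R^nat) (x : nat -> H) (n : nat) : H :=
  x n + alpha n *: (x n - x n.-1).

(* [x] and [z] are sequences generated by (IPSA); the values [z 0] and [z 1]
   are irrelevant. *)
Definition ipsa (K : set H) (f g : H -> H -> R) (alpha beta lambda : R^nat)
    (x z : nat -> H) : Prop :=
  [/\ (forall n, 0 < beta n),
      (forall n, 0 < lambda n),
      (forall n, 0 <= alpha n <= 1),
      K (x 0%N) /\ K (x 1%N)
    & forall n, (1 <= n)%N ->
        resolvent_point K g 1 (lambda n) (inertial_point alpha x n) (z n.+1) /\
        resolvent_point K f (beta n) (lambda n) (z n.+1) (x n.+1)].

End Subdifferential.

(* Main.v *)
(* Let [u] be the solution of the bilevel problem and
     E_n = |x_n - u|^2 - alpha_n |x_{n-1} - u|^2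
           + (3 alpha_n + alpha_n^2) / 2 * |x_n - x_{n-1}|^2.
   Since alpha_n is nondecreasing and at most 1/5, the two resolvent steps give
     (1 + rho lambda_n) E_{n+1} <= E_n - |x_{n+1} - z_{n+1}|^2 / 20
                                   - 2 lambda_n g(u, z_{n+1})
   for large n.  A subgradient of g_u at u and part of the strong monotonicity
   bound the iterates.  Given e > 0, either |x_{n+1} - z_{n+1}| is bounded
   below, and the quadratic term beats the last one because lambda_n -> 0; or
   it is small, and since lambda_n beta_n is bounded below, x_{n+1} almost
   satisfies f(y, x_{n+1}) <= 0 for all y in K, which forces
   g(u, z_{n+1}) >= - e.  Hence limsup E_n <= 0, because the lambda_n have
   infinite sum, and E_n controls |x_n - u|^2 as alpha_n < 1. *)
Require Import Defs.
From HB Require Import structures.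
From mathcomp Require Import all_boot all_order all_algebra.
From mathcomp Require Import all_classical all_reals all_analysis.
From mathcomp Require Import ring lra.

Set Implicit Arguments.
Unset Strict Implicit.
Unset Printing Implicit Defensive.

Import Order.TTheory GRing.Theory Num.Theory.
Import numFieldNormedType.Exports.

Local Open Scope classical_set_scope.
Local Open Scope ring_scope.

(** * Identities and inequalities for the inner product *)

Section InnerProduct.
Variables (R : realType) (H : completeNormedModType R).
Variables (ip : {dot H for idfun}) (ip_norm : induces_norm ip).
Implicit Types u v w p q : H.

Lemma ipC u v : ip u v = ip v u.
Proof. by have := hermC ip u v; rewrite /= expr0 mul1r. Qed.

Definition ip_expand :=
  (linearDl, linearDr, linearNl, linearNr, linearZl_LR, linearZr_LR).

Lemma normB_expand (t : R) p q :
  `|p - t *: q| ^+ 2 = `|p| ^+ 2 - 2 * t * ip p q + t ^+ 2 * `|q| ^+ 2.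
Proof.
rewrite !ip_norm !ip_expand /= (ipC q p) /GRing.scale/=; ring.
Qed.

Lemma ip_le p q : ip p q <= `|p| * `|q|.
Proof.
have : `|p - (-1) *: q| ^+ 2 <= (`|p| + `|q|) ^+ 2.
  by rewrite lerXn2r ?nnegrE ?addr_ge0// scaleN1r opprK ler_normD.
rewrite normB_expand; nra.
Qed.

(** Turns a resolvent inequality tested at [y] into a comparison of squared distances. *)
Lemma three_point v w y :
  2 * ip (w - v) (y - w) = `|v - y| ^+ 2 - `|w - y| ^+ 2 - `|w - v| ^+ 2.
Proof.
by rewrite !ip_norm !ip_expand /= !(ipC y) (ipC w v); ring.
Qed.

Lemma inertia_expand (t : R) u p q :
  `|p + t *: (p - q) - u| ^+ 2 =
  (1 + t) * `|p - u| ^+ 2 - t * `|q - u| ^+ 2 + t * (1 + t) * `|p - q| ^+ 2.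
Proof.
rewrite !ip_norm !ip_expand /= !(ipC u) (ipC q p) /GRing.scale/=; ring.
Qed.

(** Expanding about [w - p] leaves the cross term [-2t<w-p, p-q>], which Young's inequality bounds
    below by [-t(|w-p|^2 + |p-q|^2)]. *)
Lemma inertia_step (t : R) p q w : 0 <= t ->
  (1 - t) * `|w - p| ^+ 2 - t * (1 - t) * `|p - q| ^+ 2 <=
  `|w - (p + t *: (p - q))| ^+ 2.
Proof.
move=> t0; rewrite opprD addrA normB_expand.
have := sqr_ge0 (`|w - p - 1 *: (p - q)|); rewrite normB_expand.
set A := `|w - p|; set B := `|p - q|; set C := ip _ _; nra.
Qed.

Lemma midpoint_expand p q :
  `|2^-1 *: p + (1 - 2^-1) *: q| ^+ 2 =
  2^-1 * `|p| ^+ 2 + 2^-1 * `|q| ^+ 2 - 4^-1 * `|p - q| ^+ 2.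
Proof.
by rewrite !ip_norm !ip_expand /= (ipC q p) /GRing.scale/=; field.
Qed.

Lemma normD_sqr_le p q w :
  `|p - q| ^+ 2 <= 2 * `|p - w| ^+ 2 + 2 * `|w - q| ^+ 2.
Proof.
have -> : p - q = (p - w) - (-1) *: (w - q).
  by rewrite scaleN1r opprK addrA subrK.
have := sqr_ge0 (`|(p - w) - 1 *: (w - q)|); rewrite !normB_expand; nra.
Qed.

End InnerProduct.

(** * Recursive inequalities and limits of real sequences *)

Section RealSequences.
Variable R : realType.
Implicit Types s m : R^nat.

(** [m n.+1] is at most a weighted mean of [m n] and [C], so the bound by the maximum is preserved
    at each step. *)
Lemma recursion_bounded s m (C : R) (N : nat) :
  (forall n, (N <= n)%N -> 0 < s n) ->
  (forall n, (N <= n)%N -> (1 + s n) * m n.+1 <= m n + s n * C) ->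
  forall k n, (N <= k)%N -> (k <= n)%N -> m n <= Num.max (m k) C.
Proof.
move=> s0 hm k n Nk; elim: n => [|n IH].
  by rewrite leqn0 => /eqP->; rewrite le_max lexx.
rewrite leq_eqVlt => /predU1P[->|]; first by rewrite le_max lexx.
rewrite ltnS => kn; have Nn := leq_trans Nk kn.
have {IH} := IH kn; have := hm _ Nn; have := s0 _ Nn.
set M := Num.max _ _; have CM : C <= M by rewrite le_max lexx orbT.
nra.
Qed.

(** While [m] stays above [C + e], each step lowers it by at least [e * s n]. Divergence of the sum
    therefore forces some [m k <= C + e], and [recursion_bounded] keeps all later terms there. *)
Lemma recursion_limsup s m (C e : R) (N : nat) : 0 < e ->
  (forall n, (N <= n)%N -> 0 < s n) ->
  (forall B, exists n, B < \sum_(N <= i < n) s i) ->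
  (forall n, (N <= n)%N -> (1 + s n) * m n.+1 <= m n + s n * C) ->
  exists k, forall n, (k <= n)%N -> m n <= C + e.
Proof.
move=> e0 s0 hs hm.
have [k Nk mk] : exists2 k, (N <= k)%N & m k <= C + e.
  apply: contrapT => hno.
  have big n : (N <= n)%N -> C + e < m n.
    by move=> Nn; rewrite ltNge; apply/negP => ?; apply: hno; exists n.
  have tel j : e * \sum_(N <= i < N + j) s i <= m N - m (N + j)%N.
    elim: j => [|j IH]; first by rewrite addn0 big_geq// mulr0 subrr.
    rewrite addnS big_nat_recr ?leq_addr//=.
    have Nj := leq_addr j N.
    have := hm _ Nj; have := s0 _ Nj; have := big _ (leqW Nj).
    move: IH; nra.
  have [n] := hs ((m N - C) / e).
  have [Nn|Nn] := leqP N n; last first.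
    rewrite big_geq ?(ltnW Nn)//; have := big N (leqnn N).
    by rewrite ltr_pdivrMr// mul0r => h1 h2; lra.
  have := tel (n - N)%N; rewrite subnKC// ltr_pdivrMr//.
  by have := big n Nn; lra.
exists k => n kn; have := recursion_bounded s0 hm Nk kn.
by move/le_trans; apply; rewrite ge_max mk/= lerDl ltW.
Qed.

(** [M = e / (1 - t)] is the fixed point of [b -> t b + e]; the excess over it decays like [t ^ j]
    and eventually drops below [M] itself, whence the factor 2. *)
Lemma contraction_limsup (b : R^nat) (t e : R) (N : nat) :
  0 <= t < 1 -> 0 < e ->
  (forall n, (N <= n)%N -> b n.+1 <= t * b n + e) ->
  exists k, forall n, (k <= n)%N -> b n <= 2 * e / (1 - t).
Proof.
move=> /andP[t0 t1] e0 hb; pose M := e / (1 - t).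
have M0 : 0 < M by rewrite divr_gt0// subr_gt0.
have ME : M = t * M + e by rewrite /M; field; rewrite subr_eq0; lra.
have bd j : b (N + j)%N - M <= t ^+ j * `|b N - M|.
  elim: j => [|j IH]; first by rewrite addn0 expr0 mul1r ler_norm.
  rewrite addnS exprS -mulrA.
  have := hb _ (leq_addr j N).
  have : t * (b (N + j)%N - M) <= t * (t ^+ j * `|b N - M|) by exact: ler_wpM2l.
  set W := t * (t ^+ j * _); move: ME; clearbody M; lra.
have [k hk] : exists k, forall j, (k <= j)%N -> t ^+ j * `|b N - M| <= M.
  have : (fun j => t ^+ j * `|b N - M|) @ \oo --> (0 * `|b N - M| : R).
    apply: cvgMr_tmp; apply: cvg_expr; rewrite ger0_norm//.
  rewrite mul0r => /cvgrPdist_le/(_ _ M0)[k _ hk].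
  exists k => j kj; have := hk j kj; rewrite /= sub0r normrN.
  by move/(le_trans (ler_norm _)).
exists (N + k)%N => n Nkn.
have Nn : (N <= n)%N by apply: leq_trans Nkn; rewrite leq_addr.
have := bd (n - N)%N; rewrite subnKC// => bn.
have := hk (n - N)%N; rewrite leq_subRL// => /(_ Nkn) hn.
rewrite -mulrA -/M; lra.
Qed.

Lemma tail_sum_unbounded s : (forall n, 0 <= s n) ->
  (\sum_(0 <= n <oo) (s n)%:E = +oo)%E ->
  forall N B, exists n, B < \sum_(N <= i < n) s i.
Proof.
move=> s0 soo N B; apply: contrapT => hno.
have hB n : \sum_(N <= i < n) s i <= B.
  by rewrite leNgt; apply/negP => ?; apply: hno; exists n.
suff : (\sum_(0 <= n <oo) (s n)%:E <= (\sum_(0 <= i < N) s i + B)%:E)%E.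
  by rewrite soo.
apply: lime_le.
  by apply: is_cvg_nneseries => n _ _; rewrite lee_fin.
near=> n; rewrite sumEFin lee_fin.
have Nn : (N <= n)%N by near: n; exists N.
by rewrite (big_cat_nat (n := N))//= lerD2l.
Unshelve. all: by end_near. Qed.

Lemma limn_einf_gt0 s : (0 < limn_einf (fun n => (s n)%:E))%E ->
  exists2 c, 0 < c & exists N, forall n, (N <= n)%N -> c <= s n.
Proof.
rewrite limn_einf_lim => h.
have /= hc := @is_cvg_einfs R (fun n => (s n)%:E).
have [c /andP[c0 cl]] : exists c : R,
    ((0 < c%:E) && (c%:E < limn (einfs (fun n => (s n)%:E))))%E.
  move: h; case: (limn _) => [r| |]//.
  - rewrite lte_fin => r0; exists (r / 2); rewrite !lte_fin; lra.
  - by move=> _; exists 1; rewrite lte_fin ltr01 ltry.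
exists c; first by rewrite -lte_fin.
have [N _ hN] := hc _ (open_ereal_gt' cl); exists N => n Nn.
have := hN n Nn; rewrite /= => /ltW /le_trans.
move=> /(_ (s n)%:E); rewrite lee_fin; apply.
by apply: ereal_inf_lbound; exists n => /=.
Qed.

End RealSequences.

(** * Convexity, lower semicontinuity and approximate equilibria *)

Section Topology.
Variables (R : realType) (H : completeNormedModType R).
Variables (ip : {dot H for idfun}) (ip_norm : induces_norm ip).
Implicit Types (K : set H) (p q v w y : H).

Lemma natSinv_le (e : R) : 0 < e ->
  exists N, forall n, (N <= n)%N -> n.+1%:R^-1 <= e.
Proof.
move=> e0; have [N _ hN] := near_infty_natSinv_lt (PosNum e0).
by exists N => n /hN /ltW.
Qed.

(* Nearly norm-minimal points of the sets form a Cauchy sequence by the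
   parallelogram law; this replaces the weak compactness of bounded sets. *)
Lemma nested_convex_cvg (A : nat -> set H) (M : R) :
  (forall n, A n !=set0) ->
  (forall n p q, A n p -> A n q -> A n (2^-1 *: p + (1 - 2^-1) *: q)) ->
  (forall n, A n.+1 `<=` A n) ->
  (forall n p, A n p -> `|p| <= M) ->
  exists w : nat -> H, (forall n, A n (w n)) /\ cvgn w.
Proof.
move=> A0 Amid AS AM.
have Ale m n : (m <= n)%N -> A n `<=` A m.
  elim: n => [|n IH]; first by rewrite leqn0 => /eqP->.
  by rewrite leq_eqVlt => /predU1P[->//|]; rewrite ltnS => mn p /AS /(IH mn).
pose D n := [set `|p| ^+ 2 | p in A n].
have D0 n : has_inf (D n).
  split; first by have [p Ap] := A0 n; exists (`|p| ^+ 2), p.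
  by exists 0 => _ [p _ <-]; exact: sqr_ge0.
pose d n := inf (D n).
have dle n p : A n p -> d n <= `|p| ^+ 2.
  by move=> Ap; apply: (ge_inf (D0 n).2); exists p.
have dnd m n : (m <= n)%N -> d m <= d n.
  move=> mn; apply: lb_le_inf; first exact: (D0 n).1.
  by move=> _ [p Ap <-]; exact/dle/(Ale _ _ mn).
have dM : has_sup (range d).
  split; first by exists (d 0%N), 0%N.
  exists (M ^+ 2) => _ [n _ <-]; have [p Ap] := A0 n.
  apply: (le_trans (dle _ _ Ap)).
  by rewrite lerXn2r ?nnegrE ?(le_trans _ (AM _ _ Ap)) ?(AM _ _ Ap).
have dl n : d n <= sup (range d) by apply: (ub_le_sup dM.2); exists n.
have /choice [w hw] n : exists p, A n p /\ `|p| ^+ 2 < d n + n.+1%:R^-1.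
  have n0 : 0 < n.+1%:R^-1 :> R by rewrite invr_gt0.
  by have [_ [p Ap <-]] := inf_adherent n0 (D0 n); exists p.
exists w; split; first by move=> n; exact: (hw n).1.
apply/cauchy_cvgP/cauchy_exP => e e0.
(* The midpoint of [w N] and [w n] lies in [A N], so [|w N - w n|^2] is at most
   [2 (d n - d N + 1/(n+1) + 1/(N+1))]. The difference of the infima and both reciprocals are at
   most [e^2/16], which gives less than [e^2]. *)
have e8 : 0 < e ^+ 2 / 16 by rewrite divr_gt0// exprn_gt0.
have [_ [N1 _ <-] dN1] := sup_adherent e8 dM.
have [N2 hN2] := natSinv_le e8.
pose N := maxn N1 N2; exists (w N).
exists N => // n /= Nn; rewrite -ball_normE /=.
have := dle N _ (Amid N _ _ (hw N).1 (Ale _ _ Nn _ (hw n).1)).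
rewrite (midpoint_expand ip_norm).
have := (hw N).2; have := (hw n).2; have := dl n.
have := hN2 N (leq_maxr _ _).
have := hN2 n (leq_trans (leq_maxr _ _) Nn).
have := dnd _ _ (leq_maxl N1 N2); rewrite -/N.
rewrite -(ltr_pXn2r (n := 2))// ?nnegrE// ?(ltW e0)//.
set i := n.+1%:R^-1; set j := N.+1%:R^-1; set E := e ^+ 2 in e8 dN1 *.
set W := `|w N - w n| ^+ 2; move: dN1 e8; move: (sup _) (d N1) => S dd; lra.
Qed.

Lemma lsc_subspace_le K (phi : H -> R) (w : nat -> H) v (b : R) :
  lower_semicontinuous ((fun y => (phi y)%:E) : subspace K -> \bar R) ->
  K v -> (forall n, K (w n)) -> w @ \oo --> v ->
  (forall e, 0 < e -> exists N, forall n, (N <= n)%N -> phi (w n) <= b + e) ->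
  phi v <= b.
Proof.
move=> lsc Kv Kw wv hb; rewrite leNgt; apply/negP => bv.
have e0 : 0 < (phi v - b) / 2 by rewrite divr_gt0// subr_gt0.
have lt : ((b + (phi v - b) / 2)%:E < (phi v)%:E)%E by rewrite lte_fin; lra.
have [V /= nV hV] := lsc v _ lt.
have {nV} : within K (nbhs v) V by rewrite nbhs_subspace_in.
move=> /wv [N1 _ h1]; have [N2 h2] := hb _ e0.
have := h1 (maxn N1 N2) (leq_maxl _ _) (Kw _).
move=> /hV; rewrite lte_fin ltNge => /negP; apply.
exact/h2/leq_maxr.
Qed.

Lemma convex_setW K p q (t : R) : convex_set (K : set (convex_lmodType H)) ->
  0 <= t <= 1 -> K p -> K q -> K (t *: p + (1 - t) *: q).
Proof.
move=> cK /andP[t0 t1] Kp Kq.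
by have := cK p q (Itv01 t0 t1); rewrite !inE; apply.
Qed.

Lemma convex_functionW K (phi : H -> R) p q (t : R) :
  convex_function (K : set (convex_lmodType H)) phi ->
  0 <= t <= 1 -> K p -> K q ->
  phi (t *: p + (1 - t) *: q) <= t * phi p + (1 - t) * phi q.
Proof.
move=> cphi /andP[t0 t1] Kp Kq.
by apply: (cphi (Itv01 t0 t1) p q); rewrite inE.
Qed.

(** Minty's argument: with [v_t = t y + (1-t) v], convexity gives [0 = h(v_t,v_t) <= t h(v_t,y) +
    (1-t) h(v_t,v) <= t h(v_t,y)]. Divide by [t] and let [t] tend to 0. *)
Lemma minty K (h : H -> H -> R) v :
  convex_set (K : set (convex_lmodType H)) ->
  equilibrium_bifun K h -> upper_hemicontinuous K h ->
  K v -> (forall y, K y -> h y v <= 0) -> equilibrium_set K h v.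
Proof.
move=> cK eh uh Kv hv; split=> // y Ky.
have [l hl lh] := uh v y y Kv Ky Ky.
rewrite -lee_fin (le_trans _ lh)//.
have Hn : \forall t \near (0 : R)^'+, (0 <= (h (t *: y + (1 - t) *: v) y)%:E)%E.
  near=> t; have t0 : 0 < t by near: t; exact: nbhs_right_gt.
  have t1 : t < 1 by near: t; exact: nbhs_right_lt.
  have t01 : 0 <= t <= 1 by rewrite !ltW.
  have Kt := convex_setW cK t01 Ky Kv.
  have [ht0 htc _] := eh _ Kt.
  have := convex_functionW htc t01 Ky Kv; rewrite ht0 lee_fin.
  have := hv _ Kt; set a := h _ v; set b := h _ y => a0 hab.
  have : 0 <= t * b by nra.
  by rewrite pmulr_rge0.
rewrite -(cvg_lim _ hl)//; apply: lime_ge => //; exact: cvgP hl.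
Unshelve. all: by end_near. Qed.

(** If no [d] worked, the counterexamples for [d = 1/(n+1)] would form nested bounded sets closed
    under midpoints. A convergent selection then has its limit in [S_f] by [minty], yet [phi <= -e]
    there. In the application [phi] is [g u], [p] is [z n.+1] and [q] is [x n.+1]. *)
Lemma near_equilibrium_ge K (f : H -> H -> R) (phi : H -> R) (M e : R) :
  closed K -> convex_set (K : set (convex_lmodType H)) ->
  equilibrium_bifun K f -> upper_hemicontinuous K f ->
  convex_function (K : set (convex_lmodType H)) phi ->
  lower_semicontinuous ((fun y => (phi y)%:E) : subspace K -> \bar R) ->
  (forall y, equilibrium_set K f y -> 0 <= phi y) -> 0 < e ->
  exists2 d, 0 < d & forall p q, K p -> K q -> `|p| <= M -> `|p - q| <= d ->
    (forall y, K y -> f y q <= d * (1 + `|y|)) -> - e <= phi p.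
Proof.
move=> clK cK ef uf cphi lphi phi0 e0; apply: contrapT => hno.
pose A n := [set p | [/\ K p, `|p| <= M, phi p <= - e &
  exists q, [/\ K q, `|p - q| <= n.+1%:R^-1 &
    forall y, K y -> f y q <= n.+1%:R^-1 * (1 + `|y|)]]].
have h01 : 0 <= (2^-1 : R) <= 1 by apply/andP; split; lra.
have hh : 1 - 2^-1 = 2^-1 :> R by lra.
have [||||w [Aw cw]] := @nested_convex_cvg A M.
- move=> n; apply: contrapT => An; apply: hno.
  exists n.+1%:R^-1; first by rewrite invr_gt0.
  move=> p q Kp Kq pM pq hq; rewrite leNgt; apply/negP => pe; apply: An.
  by exists p; split => //; [exact: ltW | exists q].
- move=> n p1 p2 [Kp1 M1 e1 [q1 [Kq1 d1 f1]]] [Kp2 M2 e2 [q2 [Kq2 d2 f2]]].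
  set i := n.+1%:R^-1 in d1 d2 f1 f2 *.
  rewrite /A /= -/i; split; first exact: convex_setW.
  + rewrite hh -scalerDr normrZ ger0_norm//.
    by have := ler_normD p1 p2; lra.
  + by have := convex_functionW cphi h01 Kp1 Kp2; lra.
  exists (2^-1 *: q1 + (1 - 2^-1) *: q2); split; first exact: convex_setW.
    rewrite hh -!scalerDr -scalerBr normrZ ger0_norm// opprD addrACA.
    by have := ler_normD (p1 - q1) (p2 - q2); lra.
  move=> y Ky; have [_ cf _] := ef y Ky.
  have := convex_functionW cf h01 Kq1 Kq2; have := f1 y Ky; have := f2 y Ky.
  by set Y := 1 + _; lra.
- move=> n p [Kp pM pe [q [Kq pq fq]]].
  have nn : n.+2%:R^-1 <= n.+1%:R^-1 :> R by rewrite lef_pV2 ?posrE// ler_nat.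
  split=> //; exists q; split=> //; first exact: le_trans nn.
  by move=> y Ky; apply: (le_trans (fq y Ky)); rewrite ler_wpM2r// addr_ge0.
- by move=> n p [].
have /choice [q hq] n : exists q, [/\ K q, `|w n - q| <= n.+1%:R^-1 &
    forall y, K y -> f y q <= n.+1%:R^-1 * (1 + `|y|)] by have [] := Aw n.
pose v := limn w.
have wv : w @ \oo --> v by exact: cw.
have Kw n : K (w n) by have [] := Aw n.
have Kq n : K (q n) by have [] := hq n.
have Kv : K v.
  by apply: (@closed_cvg nat H \oo _ w K clK _ v wv); exact: nearW.
have qv : q @ \oo --> v.
  have -> : q = w - (w - q) by apply/funext => n; rewrite !fctE subKr.
  rewrite -[v]subr0; apply: cvgB => //.
  apply/cvgrPdist_le => r r0; have [N hN] := natSinv_le r0.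
  exists N => // n Nn; rewrite /= sub0r normrN; have [_ wq _] := hq n.
  exact/(le_trans wq)/hN.
have Sv : equilibrium_set K f v.
  apply: minty => // y Ky; have [_ _ lf] := ef y Ky.
  apply: (lsc_subspace_le lf Kv Kq qv) => r r0.
  have y0 : 0 < 1 + `|y| by rewrite ltr_pwDl.
  have [N hN] := natSinv_le (divr_gt0 r0 y0).
  exists N => n Nn; rewrite add0r; have [_ _ hf] := hq n.
  by apply: (le_trans (hf y Ky)); rewrite -ler_pdivlMr// hN.
have : phi v <= - e.
  apply: (lsc_subspace_le lphi Kv Kw wv) => r r0; exists 0%N => n _.
  by have [_ _ we _] := Aw n; rewrite (le_trans we)// lerDl ltW.
have := phi0 v Sv; lra.
Qed.

End Topology.

(** * Energy estimates and boundedness of the iterates *)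

Section Iteration.
Variables (R : realType) (H : completeNormedModType R).
Variables (ip : {dot H for idfun}) (ip_norm : induces_norm ip).
Variables (K : set H) (f g : H -> H -> R) (rho : R).
Hypotheses (f_mono : monotone_bifun K f) (rho_gt0 : 0 < rho).
Hypothesis g_strong : strongly_monotone_bifun K g rho.
Variables (alpha beta lambda : R^nat) (x z : nat -> H).
Hypothesis xz_ipsa : ipsa ip K f g alpha beta lambda x z.
Hypothesis alpha_nd : nondecreasing_seq alpha.
Hypothesis alpha_bound : forall n, 0 <= alpha n <= 5^-1.
Hypothesis lambda0 : lambda @ \oo --> (0 : R).
Variables (u q : H).
Hypothesis u_sol : bilevel_set K f g u.
Hypothesis q_sub : forall y, K y -> ip q (y - u) <= g u y.

Lemma lambda_le (e : R) : 0 < e ->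
  exists N, forall n, (N <= n)%N -> lambda n <= e.
Proof.
move=> e0; have /cvgrPdist_le/(_ _ e0)[N _ hN] := lambda0.
exists N => n /hN; rewrite /= sub0r normrN.
exact/le_trans/ler_norm.
Qed.

Lemma ipsa_in n : K (x n).
Proof.
case: xz_ipsa => _ _ _ [K0 K1]; case: n => [|[|n]] // /(_ n.+1 isT).
by case=> _ [].
Qed.

Lemma ipsa_z_in n : (1 <= n)%N -> K (z n.+1).
Proof. by case: xz_ipsa => _ _ _ _ + n1 => /(_ n n1) [[]]. Qed.

Lemma lambda_gt0 n : 0 < lambda n.
Proof. by case: xz_ipsa. Qed.

Lemma gap_lower n : (1 <= n)%N -> - (`|q| * `|z n.+1 - u|) <= g u (z n.+1).
Proof.
move=> n1; apply: le_trans (q_sub (ipsa_z_in n1)).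
have := ip_le ip_norm (- q) (z n.+1 - u).
by rewrite normrN linearNl; lra.
Qed.

(** Test the resolvent inequality of [g] at [u] and replace [g(z,u)] through strong monotonicity. *)
Lemma z_step n : (1 <= n)%N ->
  `|z n.+1 - u| ^+ 2 <= `|inertial_point alpha x n - u| ^+ 2
    - `|z n.+1 - inertial_point alpha x n| ^+ 2
    - 2 * lambda n * (g u (z n.+1) + rho * `|z n.+1 - u| ^+ 2).
Proof.
move=> n1; case: xz_ipsa => _ _ _ _ /(_ n n1) [[Kz /(_ u) hz] _].
have [[Ku _] _] := u_sol.
have := g_strong Kz Ku; move: hz => /(_ Ku).
have := three_point ip_norm (inertial_point alpha x n) (z n.+1) u.
have l0 := lambda_gt0 n.
have lV : lambda n * (lambda n)^-1 = 1 by rewrite divff// gt_eqF.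
set y := inertial_point alpha x n; set I := ip (z n.+1 - y) (u - z n.+1).
move=> hI hz hg.
have : 0 <= lambda n * (1 * g (z n.+1) u + (lambda n)^-1 * I).
  by rewrite mulr_ge0// ltW.
rewrite mulrDr [lambda n * (_^-1 * _)]mulrA lV.
have : lambda n * (g (z n.+1) u + g u (z n.+1)) <=
  lambda n * (- rho * `|z n.+1 - u| ^+ 2) by rewrite ler_pM2l.
lra.
Qed.

Lemma x_step n : (1 <= n)%N ->
  `|x n.+1 - u| ^+ 2 <= `|z n.+1 - u| ^+ 2 - `|x n.+1 - z n.+1| ^+ 2.
Proof.
move=> n1; case: xz_ipsa => /(_ n) b0 _ _ _ /(_ n n1) [_ [Kx /(_ u) hx]].
have [[Ku fu] _] := u_sol.
have := f_mono Kx Ku; have := fu _ Kx; move: hx => /(_ Ku).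
have := three_point ip_norm (z n.+1) (x n.+1) u.
have l0 := lambda_gt0 n.
set I := ip (x n.+1 - z n.+1) (u - x n.+1) => hI hx hf1 hf2.
have : 0 <= (lambda n)^-1 * I.
  have : beta n * f (x n.+1) u <= 0 by rewrite pmulr_rle0//; lra.
  by lra.
by rewrite pmulr_rge0 ?invr_gt0//; lra.
Qed.

(** A small gap between the two resolvent points makes [x n.+1] an approximate solution of the Minty
    inequality [f(y, .) <= 0]. *)
Lemma f_residual n y (c : R) : (1 <= n)%N -> 0 < c <= lambda n * beta n ->
  K y -> c * f y (x n.+1) <= `|z n.+1 - x n.+1| * (`|y| + `|x n.+1|).
Proof.
move=> n1 /andP[c0 cl] Ky.
case: xz_ipsa => _ _ _ _ /(_ n n1) [_ [Kx /(_ y Ky) hx]].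
have l0 := lambda_gt0 n.
have lV : lambda n * (lambda n)^-1 = 1 by rewrite divff// gt_eqF.
have : 0 <= `|z n.+1 - x n.+1| * (`|y| + `|x n.+1|).
  by rewrite mulr_ge0// addr_ge0.
(* Enlarging [c] to [lambda n * beta n] is legitimate only for positive [f y (x n.+1)]; otherwise
   the claim is trivial. *)
have [f0|f0] := leP (f y (x n.+1)) 0.
  by apply: le_trans; rewrite pmulr_rle0.
move=> _; apply: (@le_trans _ _ (lambda n * beta n * f y (x n.+1))).
  by rewrite ler_pM2r.
have : `|x n.+1 - z n.+1| * `|y - x n.+1| <=
  `|z n.+1 - x n.+1| * (`|y| + `|x n.+1|).
  by rewrite (distrC (x n.+1)) ler_wpM2l// ler_normB.
apply: le_trans; apply: le_trans (ip_le ip_norm _ _).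
move: hx; rewrite -(pmulr_rge0 _ l0) mulrDr !mulrA lV mul1r.
have := f_mono Kx Ky.
have lb0 : 0 < lambda n * beta n by exact: lt_le_trans cl.
rewrite -(ler_pM2l lb0); lra.
Qed.

(** The last coefficient equals [s(1+s) + s(1-s)/2] with [s = alpha n]: the term of [inertia_expand]
    plus half of that of [inertia_step]. *)
Definition energy n : R :=
  `|x n - u| ^+ 2 - alpha n * `|x n.-1 - u| ^+ 2
  + (3 * alpha n + alpha n ^+ 2) / 2 * `|x n - x n.-1| ^+ 2.

Lemma energy_step n : (1 <= n)%N ->
  energy n.+1 <= energy n - 25^-1 * `|x n.+1 - x n| ^+ 2
   - 10^-1 * `|x n.+1 - z n.+1| ^+ 2
   - 2 * lambda n * (g u (z n.+1) + rho * `|z n.+1 - u| ^+ 2).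
Proof.
move=> n1; have := z_step n1; have := x_step n1.
have := inertia_expand ip_norm (alpha n) u (x n) (x n.-1).
have /andP[a0 a1] := alpha_bound n; have /andP[_ a2] := alpha_bound n.+1.
have a12 : alpha n <= alpha n.+1 by exact: alpha_nd.
have := inertia_step ip_norm (x n) (x n.-1) (x n.+1) a0.
(* Used with weight 9/20 instead of 1/2, which saves a tenth of [|x n.+1 - z n.+1|^2]. *)
have := normD_sqr_le ip_norm (x n.+1) (inertial_point alpha x n) (z n.+1).
rewrite /energy /inertial_point /=.
move: (2 * lambda n * _) (x n + _) => G y.
have := sqr_ge0 `|x n.+1 - x n|; have := sqr_ge0 `|x n - x n.-1|.
have := sqr_ge0 `|x n - u|; have := sqr_ge0 `|x n.+1 - z n.+1|.
have := sqr_ge0 `|z n.+1 - y|; have := sqr_ge0 `|x n.+1 - y|.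
move: (`|x n.+1 - x n| ^+ 2) (`|x n - x n.-1| ^+ 2) (`|x n - u| ^+ 2)
 (`|x n.+1 - z n.+1| ^+ 2) (`|z n.+1 - y| ^+ 2) (`|x n.+1 - y| ^+ 2)
 (`|y - u| ^+ 2) (`|x n.-1 - u| ^+ 2) (`|x n.+1 - u| ^+ 2) (`|z n.+1 - u| ^+ 2).
move=> D' D A P Q W Y A1 A' Z W0 Q0 P0 A0 D0 D'0 hW hin hY hx hz.
move: (alpha n) (alpha n.+1) a0 a1 a2 a12 hin hY => s s' s0 s1 s2 ss hin hY.
(* Equality holds at [s = s' = 1/5], which is where 1/25 comes from. *)
have cD' : ((3 * s' + s' ^+ 2) / 2 - 9 / 20 * (1 - s) + 25^-1) * D' <= 0.
  by rewrite mulr_le0_ge0//; nra.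
(* Monotonicity of [alpha] enters here. *)
have cA : (s - s') * A <= 0 by rewrite mulr_le0_ge0//; lra.
have cD :
  (s * (1 + s) + 9 / 20 * (s * (1 - s)) - (3 * s + s ^+ 2) / 2) * D <= 0.
  by rewrite mulr_le0_ge0//; nra.
move: cD' cA cD hin hY hW hx hz; lra.
Qed.

(* The parameter [r] decides how much of the strong monotonicity is spent on
   contracting the energy; the rest is kept next to [g]. *)
Lemma energy_contraction n (r : R) : (1 <= n)%N -> 0 <= r ->
  2 * lambda n * r <= 20^-1 ->
  (1 + lambda n * r) * energy n.+1 <= energy n
    - 20^-1 * `|x n.+1 - z n.+1| ^+ 2
    - 2 * lambda n * (g u (z n.+1) + (rho - r) * `|z n.+1 - u| ^+ 2).
Proof.
move=> n1 r0 lr; have := energy_step n1.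
have l0 := lambda_gt0 n.
have : energy n.+1 <= `|x n.+1 - u| ^+ 2 + `|x n.+1 - x n| ^+ 2.
  rewrite /energy /=.
  have /andP[a0 a1] := alpha_bound n.+1.
  have := sqr_ge0 `|x n - u|; have := sqr_ge0 `|x n.+1 - x n|.
  move: (`|x n - u| ^+ 2) (`|x n.+1 - x n| ^+ 2) => A D D0 A0.
  have : 0 <= alpha n.+1 * A by rewrite mulr_ge0.
  have : ((3 * alpha n.+1 + alpha n.+1 ^+ 2) / 2 - 1) * D <= 0.
    by rewrite mulr_le0_ge0//; nra.
  by lra.
have := normD_sqr_le ip_norm (x n.+1) u (z n.+1).
have := sqr_ge0 `|x n.+1 - x n|; have := sqr_ge0 `|x n.+1 - z n.+1|.
move: (energy n.+1) (energy n) => E' E.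
move: (`|x n.+1 - x n| ^+ 2) (`|x n.+1 - z n.+1| ^+ 2) (`|z n.+1 - u| ^+ 2)
  (`|x n.+1 - u| ^+ 2) => D P Z A P0 D0 hA hE' hE.
(* After multiplication by [lambda n * r], the terms in [P] and [D] are absorbed by the 1/10 and
   1/25 of [energy_step], and the one in [Z] by the strong monotonicity. *)
have t0 : 0 <= lambda n * r by rewrite mulr_ge0// ltW.
have : lambda n * r * E' <= lambda n * r * (2 * P + 2 * Z + D).
  by apply: ler_wpM2l => //; lra.
have : (2 * lambda n * r - 20^-1) * P <= 0 by rewrite mulr_le0_ge0//; lra.
have : (lambda n * r - 25^-1) * D <= 0 by rewrite mulr_le0_ge0//; lra.
lra.
Qed.

(** The negative term of the energy has coefficient at most 1/5, so the squared distances satisfy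
    [b n.+1 <= b n / 5 + e], and eventually [b n <= 5e/2]. *)
Lemma sqr_dist_le_of_energy (e : R) (N : nat) : 0 < e ->
  (forall n, (N <= n)%N -> energy n <= e) ->
  exists k, forall n, (k <= n)%N -> `|x n - u| ^+ 2 <= 4 * e.
Proof.
move=> e0 hN.
have [||k hk] := @contraction_limsup _ (fun n => `|x n - u| ^+ 2) 5^-1 e N _ e0.
- by apply/andP; split; lra.
- move=> n Nn; have := hN n.+1 (leqW Nn); rewrite /energy /=.
  have /andP[a0 a1] := alpha_bound n.+1.
  have := sqr_ge0 `|x n - u|; have := sqr_ge0 `|x n.+1 - x n|.
  move: (`|x n - u| ^+ 2) (`|x n.+1 - x n| ^+ 2) => A D D0 A0.
  have : (alpha n.+1 - 5^-1) * A <= 0 by rewrite mulr_le0_ge0//; lra.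
  have : 0 <= (3 * alpha n.+1 + alpha n.+1 ^+ 2) / 2 * D.
    by rewrite mulr_ge0// divr_ge0// addr_ge0// ?mulr_ge0// sqr_ge0.
  by lra.
exists k => n /hk /le_trans; apply.
have -> : 1 - 5^-1 = 4 / 5 :> R by field.
by rewrite invf_div; lra.
Qed.

Lemma ipsa_bounded : exists2 M, 1 <= M & exists N, forall n, (N <= n)%N ->
  `|x n.+1 - u| <= M /\ `|z n.+1 - u| <= M.
Proof.
have [N1 hN1] : exists N, forall n, (N <= n)%N -> lambda n <= (20 * rho)^-1.
  by apply: lambda_le; rewrite invr_gt0 mulr_gt0.
have [N2 hN2] := lambda_le ltr01.
pose N := maxn 1 (maxn N1 N2).
have Ngood n : (N <= n)%N ->
  [/\ (1 <= n)%N, lambda n * rho <= 20^-1 & lambda n <= 1].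
  rewrite !geq_max => /and3P[n1 n2 n3]; split => //; last exact: hN2.
  by have := hN1 _ n2; rewrite invfM -ler_pdivlMr.
(* Completing the square: half of the strong monotonicity pays for the linear lower bound on [g u];
   the other half contracts the energy. *)
have quad n : - (`|q| ^+ 2 / (2 * rho)) <=
    - (`|q| * `|z n.+1 - u|) + rho / 2 * `|z n.+1 - u| ^+ 2.
  move: `|z n.+1 - u| `|q| => Z Q; rewrite -subr_ge0.
  have -> : - (Q * Z) + rho / 2 * Z ^+ 2 - - (Q ^+ 2 / (2 * rho)) =
    rho / 2 * (Z - Q / rho) ^+ 2 by field; rewrite gt_eqF.
  by rewrite mulr_ge0 ?sqr_ge0// divr_ge0// ltW.
pose C := 2 * (`|q| ^+ 2 / rho ^+ 2).
pose B := Num.max (energy N) C + 1.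
have C0 : 0 <= C by rewrite mulr_ge0// divr_ge0// sqr_ge0.
have B0 : 0 < B by rewrite ltr_wpDl// le_max C0 orbT.
have hB n : (N <= n)%N -> energy n <= B.
  move=> Nn; suff : energy n <= Num.max (energy N) C.
    by move/le_trans; apply; rewrite lerDl.
  pose s k := lambda k * (rho / 2).
  apply: (@recursion_bounded _ s energy C N) => //.
    by move=> k _; rewrite mulr_gt0 ?lambda_gt0// divr_gt0.
  move=> k /Ngood[k1 kr _].
  have r2 : 0 <= rho / 2 by rewrite divr_ge0// ltW.
  have kr2 : 2 * lambda k * (rho / 2) <= 20^-1 by move: kr; lra.
  apply: (le_trans (energy_contraction k1 r2 kr2)).
  have l0 := lambda_gt0 k.
  have := gap_lower k1; have := quad k; move=> hq hg.
  have : lambda k * - (`|q| ^+ 2 / (2 * rho)) <=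
    lambda k * (g u (z k.+1) + (rho - rho / 2) * `|z k.+1 - u| ^+ 2).
    by rewrite ler_pM2l//; lra.
  have -> : lambda k * (rho / 2) * C =
    2 * (lambda k * (`|q| ^+ 2 / (2 * rho))).
    by rewrite /C; field; rewrite gt_eqF.
  by have := sqr_ge0 `|x k.+1 - z k.+1|; lra.
have [k hk] := sqr_dist_le_of_energy B0 hB.
(* Eventually [|x n - u|^2 <= 4B], so the inertial point has squared distance at most
   [(6/5) 4B + (1/4) 16B <= 12B] from [u]; the last summand bounds the loss from [g]. As [M >= 1], a
   bound [M] on squares also bounds the norms. *)
pose M := 1 + 12 * B + `|q| ^+ 2 / (2 * rho) * 2.
have Q0 : 0 <= `|q| ^+ 2 / (2 * rho).
  by rewrite divr_ge0 ?sqr_ge0// mulr_ge0// ltW.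
have M1 : 1 <= M by rewrite /M; lra.
have MM : M <= M ^+ 2 by nra.
exists M => //; exists (maxn N k.+1) => n; rewrite geq_max => /andP[Nn kn].
have [n1 _ l1] := Ngood _ Nn; have l0 := lambda_gt0 n.
have hx0 := hk n.-1 ltac:(by rewrite -ltnS prednK).
have hx1 := hk n (ltnW kn); have hx2 := hk n.+1 (leqW (ltnW kn)).
have M0 : 0 <= M by lra.
split; rewrite -(ler_pXn2r (n := 2))// ?nnegrE//; apply: le_trans MM.
  by rewrite /M; lra.
have := z_step n1; rewrite /inertial_point (inertia_expand ip_norm).
have := normD_sqr_le ip_norm (x n) (x n.-1) u; rewrite (distrC u).
have /andP[a0 a1] := alpha_bound n.
have := gap_lower n1; have := quad n.
have := sqr_ge0 `|x n - x n.-1|.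
have := sqr_ge0 `|z n.+1 - (x n + alpha n *: (x n - x n.-1))|.
have := sqr_ge0 `|x n - u|; have := sqr_ge0 `|x n.-1 - u|.
have := sqr_ge0 `|z n.+1 - u|.
move: hx0 hx1; rewrite /M.
move: (`|z n.+1 - (x n + alpha n *: (x n - x n.-1))| ^+ 2) (`|x n - u| ^+ 2)
 (`|x n.-1 - u| ^+ 2) (`|x n - x n.-1| ^+ 2) => V A A1 D.
move: (`|z n.+1 - u| ^+ 2) (`|q| ^+ 2 / (2 * rho)) Q0 => Z Q Q0.
move: (alpha n) a0 a1 => s s0 s1 hA hA1 Z0 A10 A0 V0 D0 hq hg hD hz.
have rZ : 0 <= rho * Z by rewrite mulr_ge0// ltW.
have : lambda n * - Q <= lambda n * (g u (z n.+1) + rho * Z).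
  by rewrite ler_pM2l//; lra.
have : lambda n * Q <= Q by nra.
have : (s - 5^-1) * A <= 0 by rewrite mulr_le0_ge0//; lra.
have : (s * (1 + s) - 4^-1) * D <= 0 by rewrite mulr_le0_ge0//; nra.
have : 0 <= s * A1 by rewrite mulr_ge0.
lra.
Qed.

End Iteration.

(** * Uniqueness and strong convergence *)

Theorem theorem3p4 (R : realType) (H : completeNormedModType R)
    (ip : {dot H for idfun}) (ip_norm : induces_norm ip)
    (K : set H) (K_nonempty : K !=set0) (K_closed : closed K)
    (K_convex : convex_set (K : set (convex_lmodType H)))
    (f g : H -> H -> R) (fg_standing : standing_assumptions ip K f g)
    (rho : R) (rho_gt0 : 0 < rho)
    (g_strong : strongly_monotone_bifun K g rho)
    (alpha beta lambda : R^nat) (x z : nat -> H)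
    (xz_ipsa : ipsa ip K f g alpha beta lambda x z)
    (alpha_nondecreasing : nondecreasing_seq alpha)
    (a : R) (a_range : 0 <= a < (Num.sqrt 3 - 1) / 4)
    (alpha_le : forall n, 0 <= alpha n <= a)
    (lambda_sum : (\sum_(0 <= n <oo) (lambda n)%:E = +oo)%E)
    (lambda_lim : lambda @ \oo --> (0 : R))
    (beta_lim : beta @ \oo --> +oo)
    (liminf_pos : (0 < limn_einf (fun n => (lambda n * beta n)%:E))%E) :
  exists u : H, bilevel_set K f g = [set u] /\ x @ \oo --> u.
Proof.
case: fg_standing => -[u Su] [f_mono f_uhc f_eq] [_ _ g_eq] sub _.
exists u; have [[Ku fu] gu] := Su; split.
  (* Two solutions [u], [v] have [g(u,v), g(v,u) >= 0], while the sum is at most [-rho |v-u|^2]. *)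
  apply/seteqP; split => [v [[Kv fv] gv]|_ ->//]; apply/eqP.
  rewrite -subr_eq0 -normr_eq0 -[_ == 0](@expf_eq0 _ _ 2).
  rewrite eq_le sqr_ge0 andbT.
  have := g_strong _ _ Kv Ku; have := gv _ (conj Ku fu).
  have := gu _ (conj Kv fv).
  move: (`|v - u| ^+ 2) => d; nra.
have [q [_ hq]] := sub u Ku.
have [g0 g_convex g_lsc] := g_eq u Ku.
have q_sub y : K y -> ip q (y - u) <= g u y.
  move=> Ky; have := hq y; rewrite /extend_pinfty !mem_set//.
  by rewrite -EFinD lee_fin g0 add0r.
have alpha_bound n : 0 <= alpha n <= 5^-1.
  have /andP[-> an] := alpha_le n; case/andP: a_range => _ ha /=.
  (* This makes [(sqrt 3 - 1)/4 <= 1/5], the rational bound of the energy estimates. *)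
  have : Num.sqrt 3 <= 9 / 5 :> R.
    rewrite -(ler_pXn2r (n := 2))// ?nnegrE ?sqrtr_ge0//.
    by rewrite sqr_sqrtr//; lra.
  by lra.
have l0 n : 0 < lambda n by case: xz_ipsa.
have [M M1 [N1 bnd]] := ipsa_bounded ip_norm f_mono rho_gt0 g_strong xz_ipsa
  alpha_nondecreasing alpha_bound lambda_lim Su q_sub.
have [c c0 [N2 lbc]] := limn_einf_gt0 liminf_pos.
apply/cvgrPdist_le => r r0.
(* Then [2e/rho = r^2/8]; a further slack [r^2/8] brings the energy below [r^2/4], hence the squared
   distance below [r^2]. *)
pose e := rho * (r ^+ 2 / 16).
have e0 : 0 < e by rewrite mulr_gt0// divr_gt0// exprn_gt0.
have [d d0 near] := near_equilibrium_ge ip_norm (M + `|u|) K_closed K_convex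
  f_eq f_uhc g_convex g_lsc (fun y Sy => gu y Sy) e0.
pose M' := M + `|u|.
have M'1 : 0 < 1 + M' by rewrite /M' addrA ltr_wpDr//; lra.
(* The second entry converts the residual bound: [d' (|y| + M') <= d' (1 + M') (1 + |y|) <= c d (1 +
   |y|)]. *)
pose d' := Num.min d (c * d / (1 + M')).
have d'0 : 0 < d' by rewrite lt_min d0 divr_gt0// mulr_gt0.
have d'd : d' <= d by rewrite ge_min lexx.
have d'c : d' * (1 + M') <= c * d.
  by rewrite -ler_pdivlMr// ge_min lexx orbT.
have qM0 : 0 < 40 * (`|q| * M + 1).
  by rewrite mulr_gt0// ltr_wpDl// mulr_ge0//; lra.
(* Ensures [2 lambda n |q| M <= d'^2/20], so that a gap above [d'] outweighs the worst value of
   [g u]; the added 1 keeps the denominator positive. *)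
have [N3 hN3] : exists N, forall n, (N <= n)%N ->
    lambda n <= d' ^+ 2 / (40 * (`|q| * M + 1)).
  by apply: (lambda_le lambda_lim); rewrite divr_gt0// exprn_gt0.
have [N4 hN4] : exists N, forall n, (N <= n)%N -> lambda n <= (40 * rho)^-1.
  by apply: (lambda_le lambda_lim); rewrite invr_gt0 mulr_gt0.
pose N := maxn 1 (maxn (maxn N1 N2) (maxn N3 N4)).
pose E n := energy alpha x u n.
(* All of the strong monotonicity goes into the contraction ([r = rho]), and in both cases the
   remaining terms are at most [2 lambda n e]. *)
have rec n : (N <= n)%N ->
    (1 + lambda n * rho) * E n.+1 <= E n + lambda n * rho * (2 * e / rho).
  rewrite !geq_max => /and3P[n1 /andP[nN1 nN2] /andP[nN3 nN4]].
  have hl : 2 * lambda n * rho <= 20^-1.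
    by have := hN4 n nN4; rewrite invfM -ler_pdivlMr//; lra.
  apply: (le_trans (energy_contraction ip_norm f_mono g_strong xz_ipsa
    alpha_nondecreasing alpha_bound Su n1 (ltW rho_gt0) hl)).
  rewrite subrr mul0r addr0 -/(E n).
  have -> : lambda n * rho * (2 * e / rho) = 2 * (lambda n * e).
    by field; rewrite gt_eqF.
  have [xM zM] := bnd n nN1.
  have Kx := ipsa_in xz_ipsa n.+1; have Kz := ipsa_z_in xz_ipsa n1.
  have xM' : `|x n.+1| <= M'.
    by rewrite -[x n.+1](subrK u) (le_trans (ler_normD _ _))// lerD2r.
  have zM' : `|z n.+1| <= M'.
    by rewrite -[z n.+1](subrK u) (le_trans (ler_normD _ _))// lerD2r.
  have le0 : 0 <= lambda n * e by rewrite mulr_ge0// ltW.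
  have [xz_near|xz_far] := leP `|z n.+1 - x n.+1| d'.
    have : - e <= g u (z n.+1).
      apply: near Kz Kx zM' (le_trans xz_near d'd) _ => y Ky.
      have cn : 0 < c <= lambda n * beta n by rewrite c0 lbc.
      rewrite -(ler_pM2l c0).
      apply: (le_trans (f_residual ip_norm f_mono xz_ipsa n1 cn Ky)).
      rewrite mulrA; apply: le_trans (ler_wpM2r _ d'c); last first.
        by rewrite addr_ge0.
      rewrite -mulrA ler_pM// ?addr_ge0//.
      have : 0 <= M' * `|y| by rewrite mulr_ge0// (le_trans _ xM').
      by lra.
    rewrite -(ler_pM2l (l0 n)); have := sqr_ge0 `|x n.+1 - z n.+1|; lra.
  have sq : d' ^+ 2 <= `|x n.+1 - z n.+1| ^+ 2.
    by rewrite distrC lerXn2r ?nnegrE// ltW.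
  have gap : - (`|q| * M) <= g u (z n.+1).
    apply: le_trans (gap_lower ip_norm xz_ipsa q_sub n1).
    by rewrite lerN2 ler_wpM2l.
  have := hN3 n nN3; rewrite ler_pdivlMr//; move: gap.
  rewrite -(ler_pM2l (l0 n)); have := l0 n; lra.
have s0 n : (N <= n)%N -> 0 < lambda n * rho by rewrite mulr_gt0.
have s_sum B : exists n, B < \sum_(N <= i < n) lambda i * rho.
  have l0W n : 0 <= lambda n by rewrite ltW.
  have [n hn] := tail_sum_unbounded l0W lambda_sum N (B / rho).
  by exists n; rewrite -mulr_suml -ltr_pdivrMr.
have r2 : 0 < r ^+ 2 / 8 by rewrite divr_gt0// exprn_gt0.
have [k1 hk1] := recursion_limsup r2 s0 s_sum rec.
have r4 : 0 < r ^+ 2 / 4 by rewrite divr_gt0// exprn_gt0.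
have hE n : (k1 <= n)%N -> E n <= r ^+ 2 / 4.
  move=> /hk1 /le_trans; apply.
  have -> : 2 * e / rho = r ^+ 2 / 8 by rewrite /e; field; rewrite gt_eqF.
  by lra.
have [k2 hk2] := sqr_dist_le_of_energy alpha_bound r4 hE.
exists k2 => // n /hk2 /= hn; rewrite distrC.
rewrite -(ler_pXn2r (n := 2))// ?nnegrE ?(ltW r0)//; lra.
Qed.
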